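(* Let $C: f=0$ be a reduced plane curve of degree $d\geq 3$ in $\mathbb{P}^2$ of type $(d,r,m)$ with $m>3$, and suppose $\Delta m:=(2r-d+3)-m=2$. Then, with $\epsilon_1,\ldots,\epsilon_{m-2}$ as in the context, one of the following holds: (1) $\epsilon_{m-2}=3$, $\epsilon_j=1$ for $1\leq j\leq m-3$, and $\tau(C)=\frac{d(d-1)}{2}-3+r(d-r-2)$; or (2) $\epsilon_{m-2}=\epsilon_{m-3}=2$, $\epsilon_j=1$ for $1\leq j\leq m-4$, and $\tau(C)=\frac{d(d-1)}{2}-2+r(d-r-2)$.
   Context: Let $S=\mathbb{C}[x,y,z]$, let $f\in S$ be a reduced homogeneous polynomial of degree $d\geq 3$ defining $C$, and assume $C$ is not a union of $d$ lines through one point. Let $J_f=(f_x,f_y,f_z)$ and $M(f)=S/J_f$. Let $D_0(f)=\{(a,b,c)\in S^3: af_x+bf_y+cf_z=0\}$. The curve is of type $(d,r,m)$ if $D_0(f)$ is minimally generated by $m$ homogeneous elements all of degree $r$. When $m\geq 3$, the minimal graded free resolution of $M(f)$ has the form $$0\to \bigoplus_{i=1}^{m-2}S(-e_i)\to \bigoplus_{j=1}^m S(1-d-r)\to S^3(1-d)\to S,$$ with $e_1\leq\cdots\leq e_{m-2}$, and one writes $e_j=d+r-1+\epsilon_j$ with integers $\epsilon_j\geq 1$. The total Tjurina number $\tau(C)$ is the degree of $J_f$, i.e. the sum of the Tjurina numbers of the singular points of $C$. *)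

(* Defs.v *)
From HB Require Import structures.
From mathcomp Require Import all_boot all_order all_algebra.
From mathcomp Require Import mpoly.
Set Implicit Arguments. Unset Strict Implicit. Unset Printing Implicit Defensive.
Import GRing.Theory Num.Theory.
Local Open Scope ring_scope.

Notation S K := {mpoly K[3]}.

Section Defs.
Variable K : numClosedFieldType.

Definition jac (f : S K) : 'I_3 -> S K := fun k => mderiv k f.

Definition reduced (f : S K) : Prop :=
  f != 0 /\ forall g h : S K, f = g * g * h -> (msize g <= 1)%N.

Definition lines_through_point (d : nat) (f : S K) : Prop :=
  exists p : 'I_3 -> K, (exists i, p i != 0) /\
  exists l : 'I_d -> S K,
    (forall i, l i \is 1.-homog /\ (l i).@[p] = 0) /\ f = \prod_(i < d) l i.

Definition in_span (m n : nat) (g : 'I_m -> 'I_n -> S K) (v : 'I_n -> S K) :=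
  exists h : 'I_m -> S K, forall k, v k = \sum_(j < m) h j * g j k.

Definition D0 (f : S K) (v : 'I_3 -> S K) : Prop :=
  \sum_(k < 3) v k * jac f k = 0.

Definition syz (m n : nat) (g : 'I_m -> 'I_n -> S K) (h : 'I_m -> S K) : Prop :=
  forall k, \sum_(j < m) h j * g j k = 0.

Definition min_homog_gens (m n : nat) (M : ('I_n -> S K) -> Prop)
    (g : 'I_m -> 'I_n -> S K) (deg : 'I_m -> nat) : Prop :=
  [/\ forall j, M (g j),
      forall j k, g j k \is (deg j).-homog,
      forall v, M v -> in_span g v
    & forall j, ~ in_span (fun i => if i == j then (fun _ => 0) else g i) (g j)].

Definition curve_type (f : S K) (r m : nat) : Prop :=
  exists g : 'I_m -> 'I_3 -> S K, min_homog_gens (@D0 f) g (fun _ => r).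

Definition in_Jf (f : S K) (p : S K) : Prop :=
  exists a : 'I_3 -> S K, p = \sum_(k < 3) a k * jac f k.

Definition quot_dim (f : S K) (k n : nat) : Prop :=
  (exists p : 'I_n -> S K, (forall i, p i \is k.-homog) /\
     forall c : 'I_n -> K, in_Jf f (\sum_(i < n) c i *: p i) -> forall i, c i = 0)
  /\ (forall p : 'I_n.+1 -> S K, (forall i, p i \is k.-homog) ->
     exists c : 'I_n.+1 -> K, in_Jf f (\sum_(i < n.+1) c i *: p i) /\ exists i, c i != 0).

(* total Tjurina number = deg J_f = constant value of the Hilbert function of
   M(f) = S/J_f in large degrees *)
Definition tjurina (f : S K) (t : nat) : Prop :=
  exists N, forall k, (N <= k)%N -> quot_dim f k t.

End Defs.

(* Main.v *)
Require Import Defs.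
From HB Require Import structures.
From mathcomp Require Import all_boot all_order all_algebra.
From mathcomp Require Import mpoly zify ring.
Import GRing.Theory Num.Theory.
Local Open Scope ring_scope.

(** The matrix [G] of generators of [D0 f] annihilates the column of partial
    derivatives, so it has rank at most 2 over the fraction field and its module
    of syzygies has rank at least [m - 2]; being generated by [m - 2]
    elements, it is free on them, and no syzygy theorem is needed. Counting
    dimensions in each large degree then expresses [tau] by binomials
    ['C(n, 2)], where the coefficients of [n] and [1] give
    [sum eps = 2r - d + 1] and a formula for [2 tau] in terms of
    [sum eps ^ 2]. Under the hypothesis, [sum eps = m], and by minimality every
    [eps j] is positive: the [m - 2] numbers [eps j - 1] have sum 2. *)

(** * Homogeneous components and partial derivatives *)

Lemma mderiv_homog {n : nat} {R : nzRingType} (d : nat) (i : 'I_n)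
    (p : {mpoly R[n]}) :
  p \is d.-homog -> p^`M(i) \is d.-1.-homog.
Proof.
move=> hp; apply/dhomogP => m; rewrite mcoeff_msupp mcoeff_deriv => nz.
suff -> : d = (mdeg m).+1 by [].
apply/esym/eqP; apply: contraNT nz => ne.
by rewrite (dhomog_nemf_coeff hp) ?mul0rn //= mdegD mdeg1 addn1.
Qed.

(** When [p] is split into homogeneous components, only the one of degree [N - e] contributes to
    degree [N] of the product. Arbitrary coefficients can thus be traded for homogeneous ones. *)
Lemma pihomogMr {n : nat} {R : nzRingType} (N e : nat) (p q : {mpoly R[n]}) :
  (e <= N)%N -> q \is e.-homog ->
  pihomog mdeg N (p * q) = pihomog mdeg (N - e) p * q.
Proof.
move=> leeN hq.
have hmul d : pihomog mdeg d p * q \is (d + e).-homog.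
  by apply: dhomogM => //; exact: pihomogP.
pose k := maxn (mmeasure mdeg p) (N - e).+1.
have {1}-> : p = \sum_(d < k) pihomog mdeg d p.
  by apply: pihomog_partitionE; apply: leq_maxl.
have ltk : (N - e < k)%N by apply: leq_maxr.
rewrite mulr_suml linear_sum (bigD1 (Ordinal ltk)) //= big1 ?addr0.
  by rewrite pihomog_dE // -{2}(subnK leeN).
move=> d ne; apply: (pihomog_ne0 _ (hmul d)).
by apply: contra ne => /eqP E; apply/eqP/val_inj; rewrite /= -E addnK.
Qed.

(** Differentiation in a variable of the leading monomial multiplies the leading coefficient by a
    positive exponent, which is nonzero in characteristic 0. *)
Lemma jac_neq0 {K : numClosedFieldType} {d : nat} (f : {mpoly K[3]}) :
  (0 < d)%N -> f \is d.-homog -> f != 0 -> exists k, jac f k != 0.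
Proof.
move=> d_gt0 hf nzf.
have hm : mdeg (mlead f) = d by apply: (dhomog_mf hf); rewrite mlead_supp.
have [i mi] : exists i, (0 < mlead f i)%N.
  apply/existsP; apply: contraTT d_gt0; rewrite negb_exists -hm => /forallP h.
  by rewrite mdegE big1 // => i _; apply/eqP; rewrite -leqn0 leqNgt.
exists i; apply: contraNneq nzf => /(congr1 (mcoeff (mlead f - U_(i))%MM)).
rewrite mcoeff_deriv mcoeff0 submK; last by rewrite lep1mP -lt0n.
by move/eqP; rewrite mulrn_eq0 /= mleadc_eq0.
Qed.

(** * Passage to the fraction field and freeness of the syzygies *)

Lemma fraction_numden {R : idomainType} (x : {fraction R}) :
  exists d n : R, d != 0 /\ tofrac d * x = tofrac n.
Proof.
elim/quotW: x => r; exists r.2, r.1; split; first exact: denom_ratioP.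
unlock FracField.tofrac; rewrite -[LHS]FracField.pi_mul; apply/eqmodP => /=.
rewrite FracField.equivfE /FracField.mulf !numden_Ratio ?mul1r ?oner_eq0 ?denom_ratioP //.
by rewrite mulr1.
Qed.

Lemma common_denominator {R : idomainType} {m : nat} (v : 'I_m -> {fraction R}) :
  exists q : R, q != 0 /\
  exists h : 'I_m -> R, forall j, tofrac q * v j = tofrac (h j).
Proof.
elim: m v => [|m IHm] v.
  by exists 1; split; [exact: oner_neq0 | exists (fun _ => 0); case].
have [q [nzq [h hE]]] := IHm (fun j => v (lift ord0 j)).
have [d [n [nzd dE]]] := fraction_numden (v ord0).
exists (q * d); split; first by rewrite mulf_neq0.
exists (fun j => if unlift ord0 j is Some i then d * h i else q * n) => j.
case: unliftP => [i|] ->; rewrite !tofracM -?hE -?dE ?mulrA //.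
by rewrite [_ * tofrac d]mulrC.
Qed.

(** Over the fraction field the left kernel of [G] has dimension at least [p]. Each of its rows,
    cleared of denominators, is a polynomial syzygy, so the kernel lies in the span of the [p] rows
    of [s], which are therefore independent. *)
Lemma syz_gens_free {K : numClosedFieldType} {m n p : nat}
    (g : 'I_m -> 'I_n -> {mpoly K[3]}) (s : 'I_p -> 'I_m -> {mpoly K[3]}) :
  (p + \rank (\matrix_(j, k) tofrac (g j k)) <= m)%N ->
  (forall h, syz g h -> in_span s h) ->
  forall c, syz s c -> forall i, c i = 0.
Proof.
set G := \matrix_(j, k) _ => le_m gen c sc.
pose T : 'M_(p, m) := \matrix_(i, j) tofrac (s i j).
have kerT : (kermx G <= T)%MS.
  apply/row_subP => i.
  have [q [nzq [h hE]]] := common_denominator (fun j => row i (kermx G) 0 j).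
  have hq : \row_j tofrac (h j) = tofrac q *: row i (kermx G).
    by apply/rowP => j; rewrite !mxE -hE !mxE.
  have [a aE] : in_span s h.
    apply: gen => k; apply/eqP; rewrite -tofrac_eq0 rmorph_sum /=.
    have /rowP/(_ k) : \row_j tofrac (h j) *m G = 0.
      by rewrite hq -scalemxAl -row_mul mulmx_ker row0 scaler0.
    rewrite !mxE => e0; apply/eqP; rewrite -[RHS]e0; apply: eq_bigr => j _.
    by rewrite rmorphM !mxE.
  have -> : row i (kermx G) = (tofrac q)^-1 *: \row_j tofrac (h j).
    by rewrite hq scalerA mulVf ?scale1r // tofrac_eq0.
  apply: scalemx_sub.
  have -> : \row_j tofrac (h j) = \row_i tofrac (a i) *m T.
    apply/rowP => j; rewrite !mxE aE rmorph_sum; apply: eq_bigr => l _.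
    by rewrite rmorphM !mxE.
  exact: submxMl.
have freeT : row_free T.
  rewrite /row_free eqn_leq rank_leq_row /=.
  apply: leq_trans (mxrankS kerT); rewrite mxrank_ker leq_subRL ?rank_leq_row //.
  by rewrite addnC.
have /eqP : \row_i tofrac (c i) *m T = 0.
  apply/rowP => j; rewrite !mxE.
  have /(congr1 (@tofrac _)) := sc j; rewrite rmorph0 rmorph_sum => e0.
  by rewrite -[RHS]e0; apply: eq_bigr => l _; rewrite rmorphM !mxE.
rewrite mulmx_free_eq0 // => /eqP/rowP c0 i; apply/eqP.
by rewrite -tofrac_eq0; move: (c0 i); rewrite !mxE => ->.
Qed.

(** * Graded pieces as finite-dimensional vector spaces *)

Notation hform K := (dhomog 3 K).

Definition hpart {K : numClosedFieldType} (N : nat) (p : {mpoly K[3]}) : hform K N :=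
  DHomog (pihomogP mdeg N p).

Lemma hpartK {K : numClosedFieldType} (N : nat) (p : {mpoly K[3]}) :
  p \is N.-homog -> hpart N p = p :> {mpoly K[3]}.
Proof. exact: pihomog_dE. Qed.

Lemma hpart_val {K : numClosedFieldType} (N : nat) (h : hform K N) :
  hpart N (val h) = h.
Proof. exact/val_inj/hpartK/dhomog_is_dhomog. Qed.

Lemma dim_hform (K : numClosedFieldType) (N : nat) : dim (hform K N) = 'C(N + 2, 2).
Proof. by rewrite -(@bin_sub (N + 2) 2) ?addnK // leq_addl. Qed.

Lemma dim_hform_ffun (K : numClosedFieldType) (m N : nat) :
  dim {ffun 'I_m -> hform K N} = (m * 'C(N + 2, 2))%N.
Proof. by rewrite -(dim_hform K) -[in RHS](card_ord m). Qed.

Section GradedSpan.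
Context {K : numClosedFieldType}.
Implicit Types (m n e M N : nat).

(* Composing with the projection [hpart] makes multiplication by [v] linear
   whatever [M], [N] and [v]. *)
Definition row_scale {n} M N (v : 'I_n -> {mpoly K[3]}) (h : hform K M) :
    {ffun 'I_n -> hform K N} :=
  [ffun k => hpart N ((h : {mpoly K[3]}) * v k)].

Lemma row_scale_is_linear {n} M N (v : 'I_n -> {mpoly K[3]}) :
  linear (row_scale M N v).
Proof.
move=> a p q; apply/ffunP => k; rewrite !ffunE; apply: val_inj => /=.
by rewrite mulrDl -scalerAl linearP.
Qed.

HB.instance Definition _ n M N (v : 'I_n -> {mpoly K[3]}) :=
  GRing.isLinear.Build K (hform K M) {ffun 'I_n -> hform K N} _ (row_scale M N v)
    (row_scale_is_linear M N v).

(* Junk value: when [N < e j], [N - e j] is truncated to 0 and row [j] wrongly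
   contributes. *)
Definition graded_span {m n} (g : 'I_m -> 'I_n -> {mpoly K[3]})
    (e : 'I_m -> nat) N : {vspace {ffun 'I_n -> hform K N}} :=
  (\sum_j limg (linfun (row_scale (N - e j) N (g j))))%VS.

Lemma row_scaleE {n} e N (v : 'I_n -> {mpoly K[3]}) (h : hform K (N - e)) k :
  (e <= N)%N -> v k \is e.-homog ->
  row_scale (N - e) N v h k = val h * v k :> {mpoly K[3]}.
Proof.
move=> leeN hv; rewrite ffunE hpartK // -{2}(subnK leeN).
by apply: dhomogM => //; apply: dhomog_is_dhomog.
Qed.

(** Since [v] is homogeneous of degree [N], replacing each coefficient [h j] by its component of
    degree [N - e j] leaves the combination unchanged. *)
Lemma mem_graded_span {m n} (g : 'I_m -> 'I_n -> {mpoly K[3]}) (e : 'I_m -> nat) N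
    (v : {ffun 'I_n -> hform K N}) :
  (forall j k, g j k \is (e j).-homog) -> (forall j, (e j <= N)%N) ->
  reflect (in_span g (fun k => v k : {mpoly K[3]})) (v \in graded_span g e N).
Proof.
move=> hg leN; apply: (iffP memv_sumP) => [[vs vsP ->]|[h hE]].
  have /fin_all_exists [h hE] j : exists h, vs j = row_scale (N - e j) N (g j) h.
    by have /memv_imgP[h _ ->] := vsP j isT; exists h; rewrite lfunE.
  exists (fun j => val (h j)) => k; rewrite sum_ffunE raddf_sum.
  by apply: eq_bigr => j _; rewrite hE /= row_scaleE.
exists (fun j => row_scale (N - e j) N (g j) (hpart _ (h j))) => [j _|].
  by rewrite -lfunE memv_img ?memvf.
apply/ffunP => k; apply: val_inj => /=.
rewrite -[LHS](pihomog_dE (dhomog_is_dhomog _)) [val _]hE.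
rewrite linear_sum sum_ffunE raddf_sum; apply: eq_bigr => j _.
by rewrite /= row_scaleE // (pihomogMr _ (e j)).
Qed.

(** Freeness makes the sum of the images direct and each multiplication map injective, so the
    dimensions of the spaces of coefficients add up. *)
Lemma dim_graded_span_free {m n} (g : 'I_m -> 'I_n -> {mpoly K[3]})
    (e : 'I_m -> nat) N :
  (forall j k, g j k \is (e j).-homog) -> (forall j, (e j <= N)%N) ->
  (forall h, syz g h -> forall j, h j = 0) ->
  \dim (graded_span g e N) = (\sum_j 'C(N - e j + 2, 2))%N.
Proof.
move=> hg leN gfree.
(* Used twice: for directness, and, on families supported at one index, for the injectivity of a
   single multiplication map. *)
have inj (us : forall j, hform K (N - e j)) :
    \sum_j row_scale (N - e j) N (g j) (us j) = 0 -> forall j, us j = 0.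
  move=> /ffunP us0 j; apply: val_inj; move: j => /=; apply: gfree => k.
  have /(congr1 val) := us0 k; rewrite sum_ffunE ffunE raddf_sum /= => E.
  by rewrite -[RHS]E; apply: eq_bigr => j _; rewrite row_scaleE.
have dx : directv (\sum_j limg (linfun (row_scale (N - e j) N (g j)))).
  apply/directv_sum_independent => us Uus.
  have /fin_all_exists [h hE] j : exists h, us j = row_scale (N - e j) N (g j) h.
    by have /memv_imgP[h _ ->] := Uus j isT; exists h; rewrite lfunE.
  rewrite (eq_bigr _ (fun j _ => hE j)) => /inj h0 j _.
  by rewrite hE h0 linear0.
rewrite /graded_span (directvP dx) /=; apply: eq_bigr => j _.
rewrite limg_dim_eq; first by rewrite dimvf dim_hform.
apply/eqP; rewrite -subv0; apply/subvP => h; rewrite memv_cap memvf memv0 memv_ker.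
rewrite lfunE => /eqP h0.
pose us i : hform K (N - e i) := if i == j then hpart _ (val h) else 0.
have := inj us; rewrite (bigD1 j) //= big1 => [|i ne]; last first.
  by rewrite /us (negbTE ne) linear0.
have -> : us j = h by rewrite /us eqxx hpart_val.
by rewrite addr0 => /(_ h0 j); rewrite /us eqxx hpart_val => /eqP.
Qed.

Definition row_comb {m n} (g : 'I_m -> 'I_n -> {mpoly K[3]}) M N
    (h : {ffun 'I_m -> hform K M}) : {ffun 'I_n -> hform K N} :=
  \sum_j row_scale M N (g j) (h j).

Lemma row_comb_is_linear {m n} (g : 'I_m -> 'I_n -> {mpoly K[3]}) M N :
  linear (row_comb g M N).
Proof.
move=> a p q; rewrite /row_comb scaler_sumr -big_split; apply: eq_bigr => j _.
by rewrite !ffunE linearP.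
Qed.

HB.instance Definition _ m n (g : 'I_m -> 'I_n -> {mpoly K[3]}) M N :=
  GRing.isLinear.Build K {ffun 'I_m -> hform K M} {ffun 'I_n -> hform K N} _
    (row_comb g M N) (row_comb_is_linear g M N).

Definition graded_syz {m n} (g : 'I_m -> 'I_n -> {mpoly K[3]}) e M :
    {vspace {ffun 'I_m -> hform K M}} :=
  lker (linfun (row_comb g M (M + e))).

Lemma mem_graded_syz {m n} (g : 'I_m -> 'I_n -> {mpoly K[3]}) e M
    (h : {ffun 'I_m -> hform K M}) :
  (forall j k, g j k \is e.-homog) ->
  reflect (syz g (fun j => val (h j))) (h \in graded_syz g e M).
Proof.
move=> hg; rewrite memv_ker lfunE.
have E k : val (row_comb g M (M + e) h k) = \sum_j val (h j) * g j k.
  rewrite /row_comb sum_ffunE raddf_sum; apply: eq_bigr => j _.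
  by rewrite ffunE /= pihomog_dE // dhomogM // dhomog_is_dhomog.
apply: (iffP eqP) => [h0 k|sh]; first by rewrite -E h0 ffunE.
by apply/ffunP => k; apply: val_inj; rewrite [LHS]E sh ffunE.
Qed.

(** Rank-nullity for [row_comb]: as all rows have the same degree [e], its image is the graded
    span. *)
Lemma dim_graded_syz {m n} (g : 'I_m -> 'I_n -> {mpoly K[3]}) e M :
  (\dim (graded_syz g e M) + \dim (graded_span g (fun _ => e) (M + e)) =
   m * 'C(M + 2, 2))%N.
Proof.
have dimM : \dim {: {ffun 'I_m -> hform K M}} = (m * 'C(M + 2, 2))%N.
  by rewrite dimvf dim_hform_ffun.
rewrite -dimM -(limg_ker_dim (linfun (row_comb g M (M + e))) fullv).
rewrite (capv_idPr (subvf _)); congr (_ + _)%N.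
have eM : (M + e - e)%N = M by rewrite addnK.
congr (\dim _); apply/eqP; rewrite /graded_span eM eqEsubv; apply/andP; split.
  apply/subv_sumP => j _; apply/subvP => _ /memv_imgP[h _ ->].
  have -> : linfun (row_scale M (M + e) (g j)) h =
    linfun (row_comb g M (M + e)) [ffun i => if i == j then h else 0].
    rewrite !lfunE /= /row_comb (bigD1 j) //= big1 ?ffunE ?eqxx ?addr0 //.
    by move=> i ne; rewrite ffunE (negbTE ne) linear0.
  by rewrite memv_img ?memvf.
apply/subvP => _ /memv_imgP[h _ ->]; rewrite lfunE.
by apply: memv_sumr => j _; rewrite -lfunE memv_img ?memvf.
Qed.

End GradedSpan.

(** * The Hilbert function of the Jacobian quotient as a codimension *)

(** Independence modulo [U] makes the span of the [p i] meet [U] trivially, which bounds [n] above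
    by the codimension. Were the codimension larger, a complement of [U] would contain [n.+1]
    vectors independent modulo [U]. *)
Lemma codim_eq {F : fieldType} {V : vectType F} (U : {vspace V}) (n : nat) :
  (exists p : 'I_n -> V, forall c : 'I_n -> F,
     \sum_i c i *: p i \in U -> forall i, c i = 0) ->
  (forall p : 'I_n.+1 -> V, exists c : 'I_n.+1 -> F,
     \sum_i c i *: p i \in U /\ exists i, c i != 0) ->
  (n + \dim U)%N = \dim {:V}.
Proof.
move=> [p pfree] dep; apply/eqP; rewrite eqn_leq; apply/andP; split.
  pose X := [tuple p i | i < n].
  have XE (c : 'I_n -> F) : \sum_i c i *: X`_i = \sum_i c i *: p i.
    by apply: eq_bigr => i _; rewrite nth_mktuple.
  have freeX : free X.
    by apply/freeP => c; rewrite XE => c0; apply: pfree; rewrite c0 mem0v.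
  have dimX : \dim <<X>> = n by rewrite (eqP freeX) size_tuple.
  rewrite -{1}dimX -dimv_disjoint_sum ?dimvS ?subvf //.
  apply/eqP; rewrite -subv0; apply/subvP => v /memv_capP[vX vU]; rewrite memv0.
  rewrite (coord_span vX) big1 // => i _.
  rewrite (pfree (fun i => coord X i v)) ?scale0r //.
  by rewrite -XE -(coord_span vX).
rewrite leqNgt; apply/negP => lt_dim.
have lt_n : (n < \dim U^C)%N by rewrite dimv_compl ltn_subRL addnC.
have le_n : (n.+1 <= size (vbasis U^C))%N by rewrite size_tuple.
pose Y := take n.+1 (vbasis U^C).
have szY : size Y == n.+1 by rewrite size_takel.
have freeY : free Y.
  apply: (@catl_free _ _ (drop n.+1 (vbasis U^C))).
  by rewrite cat_take_drop (basis_free (vbasisP _)).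
have [c [cU [i]]] := dep (fun i => Y`_i).
have /freeP/(_ c) c0 : free (Tuple szY) by [].
rewrite c0 ?eqxx //; apply/eqP; rewrite -memv0 -(capv_compl U) memv_cap cU /=.
apply: memv_suml => j _; apply: memvZ; apply: vbasis_mem.
by rewrite (mem_take (n0 := n.+1)) // mem_nth // (eqP szY).
Qed.

(** As a matrix with one column, the partial derivatives have [D0 f] as syzygy module and the
    Jacobian ideal as span, so the same dimension lemmas apply to both. *)
Definition jac_col {K : numClosedFieldType} (f : {mpoly K[3]}) :
  'I_3 -> 'I_1 -> {mpoly K[3]} := fun k _ => jac f k.

Lemma quot_dim_graded_span {K : numClosedFieldType} (d k t : nat) (f : {mpoly K[3]}) :
  f \is d.-homog -> (d.-1 <= k)%N -> quot_dim f k t ->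
  (t + \dim (graded_span (jac_col f) (fun _ => d.-1) k))%N = 'C(k + 2, 2).
Proof.
move=> hf led [ex all].
have hg j l : jac_col f j l \is d.-1.-homog by apply: mderiv_homog.
have mem (v : {ffun 'I_1 -> hform K k}) :
    in_Jf f (val (v ord0)) <-> v \in graded_span (jac_col f) (fun _ => d.-1) k.
  split=> [[a aE]|]; first by apply/mem_graded_span => //; exists a => l; rewrite [l]ord1.
  by move/mem_graded_span => [] // a aE; exists a; apply: aE.
have sumE n (c : 'I_n -> K) (p : 'I_n -> {ffun 'I_1 -> hform K k}) :
    val ((\sum_i c i *: p i) ord0) = \sum_i c i *: val (p i ord0).
  by rewrite sum_ffunE raddf_sum; apply: eq_bigr => i _; rewrite ffunE.
rewrite -[RHS]mul1n -(dim_hform_ffun K) -dimvf; apply: codim_eq.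
  have [p [hp pfree]] := ex.
  exists (fun i => [ffun _ => hpart k (p i)]) => c /mem.
  rewrite sumE => H; apply: pfree; move: H; congr in_Jf.
  by apply: eq_bigr => i _; rewrite ffunE /= pihomog_dE.
move=> p; have [i|c [cJ nz]] := all (fun i => val (p i ord0)).
  exact: dhomog_is_dhomog.
by exists c; split=> //; apply/mem; rewrite sumE.
Qed.

(** * Dimension count along the resolution *)

Lemma syz_in_span {K : numClosedFieldType} {m n p : nat}
    (g : 'I_m -> 'I_n -> {mpoly K[3]}) (s : 'I_p -> 'I_m -> {mpoly K[3]}) h :
  (forall i, syz g (s i)) -> in_span s h -> syz g h.
Proof.
move=> sg [a aE] k; under eq_bigr => j _ do rewrite aE mulr_suml.
rewrite exchange_big /= big1 // => i _.
by under eq_bigr => j _ do rewrite -mulrA; rewrite -mulr_sumr sg mulr0.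
Qed.

Lemma graded_span_syz {K : numClosedFieldType} {m n p : nat}
    (g : 'I_m -> 'I_n -> {mpoly K[3]}) e
    (s : 'I_p -> 'I_m -> {mpoly K[3]}) (eps : 'I_p -> nat) N :
  (forall j k, g j k \is e.-homog) -> (forall i j, s i j \is (eps i).-homog) ->
  (forall i, (eps i <= N)%N) ->
  (forall i, syz g (s i)) -> (forall h, syz g h -> in_span s h) ->
  graded_span s eps N = graded_syz g e N.
Proof.
move=> hg hs leN sg gen; apply/vspaceP => h.
apply/mem_graded_span/mem_graded_syz => // [hspan|]; last exact: gen.
exact: (syz_in_span _ s).
Qed.

Lemma D0_syz {K : numClosedFieldType} (f : {mpoly K[3]}) v :
  D0 f v <-> syz (jac_col f) v.
Proof. by split=> [H k|/(_ ord0)]. Qed.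

(** The alternating sum of dimensions along the resolution in degree [n + r + d.-1], with terms
    moved across the equality to avoid truncated subtraction. *)
Lemma hilbert_count {K : numClosedFieldType} {d r m p : nat} (f : {mpoly K[3]})
    (g : 'I_m -> 'I_3 -> {mpoly K[3]}) (s : 'I_p -> 'I_m -> {mpoly K[3]})
    (eps : 'I_p -> nat) (tau n : nat) :
  (0 < d)%N -> f != 0 -> f \is d.-homog -> (p + 2 <= m)%N ->
  min_homog_gens (@D0 K f) g (fun _ => r) ->
  min_homog_gens (@syz K m 3 g) s eps ->
  (forall i, (eps i <= n)%N) -> quot_dim f (n + r + d.-1) tau ->
  (m * 'C(n + 2, 2) + 'C(n + r + d.-1 + 2, 2) =
   3 * 'C(n + r + 2, 2) + tau + \sum_i 'C(n - eps i + 2, 2))%N.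
Proof.
move=> d_gt0 nzf hf lep [gD0 hg gen _] [ssyz hs sgen _] len qd.
have hj j l : jac_col f j l \is d.-1.-homog by apply: mderiv_homog.
have gJ j : syz (jac_col f) (g j) by apply/D0_syz.
have sfree : forall c, syz s c -> forall i, c i = 0.
  (* Since [p + 2 <= m], it suffices that [G] has rank at most 2; this holds because [G] kills the
     nonzero column [J] of height 3. *)
  apply: (syz_gens_free g) sgen; apply: leq_trans lep; rewrite leq_add2l.
  set G := \matrix_(_, _) _.
  have [k nzk] := jac_neq0 f d_gt0 hf nzf.
  pose J : 'cV[{fraction {mpoly K[3]}}]_3 := \col_i tofrac (jac f i).
  have GJ : G *m J = 0.
    apply/matrixP => i j; rewrite !mxE.
    have /(congr1 (@tofrac _)) := gD0 i; rewrite rmorph0 rmorph_sum => e0.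
    by rewrite -[RHS]e0; apply: eq_bigr => l _; rewrite rmorphM !mxE.
  have nzJ : J != 0.
    apply: contraNneq nzk => /matrixP/(_ k ord0) /eqP.
    by rewrite !mxE tofrac_eq0.
  rewrite -ltnS -addn1; apply: leq_trans (mulmx0_rank_max GJ).
  by rewrite leq_add2l lt0n mxrank_eq0.
have eD : graded_span g (fun _ => r) (n + r) = graded_syz (jac_col f) d.-1 (n + r).
  apply: graded_span_syz => // [j|h /D0_syz]; first exact: leq_addl.
  exact: gen.
have eS : graded_span s eps n = graded_syz g r n by apply: graded_span_syz.
(* Rank-nullity is applied twice, first to the partial derivatives and then to the generators [g];
   by [eD] and [eS] each kernel is the span at the next stage. *)
have := dim_graded_syz (jac_col f) d.-1 (n + r).
have := dim_graded_syz g r n.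
rewrite -eD -eS (dim_graded_span_free s) //.
have := quot_dim_graded_span _ _ _ _ hf (leq_addl _ _) qd.
lia.
Qed.

(** * Comparison of coefficients in the Hilbert polynomial *)

Lemma bin2_int (n : nat) : ('C(n + 2, 2)%:Z * 2 = (n%:Z + 1) * (n%:Z + 2)).
Proof.
have := bin_ffact (n + 2) 2; rewrite ffactnS ffactn1 factS fact_prod big_nat1; nia.
Qed.

(** Doubling turns the count into a polynomial identity in [n]. Its quadratic terms cancel because
    [m = p + 2]; the linear coefficient yields the sum of the [eps i], and the constant one yields
    [tau]. *)
Lemma hilbert_count_coefs (p m r d tau : nat) (eps : 'I_p -> nat) n0 :
  m = (p + 2)%N -> (0 < d)%N ->
  (forall n, (n0 <= n)%N ->
  (m * 'C(n + 2, 2) + 'C(n + r + d.-1 + 2, 2) =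
   3 * 'C(n + r + 2, 2) + tau + \sum_i 'C(n - eps i + 2, 2))%N) ->
  (forall i, (eps i <= n0)%N) ->
  (\sum_i eps i)%:Z = 2 * r%:Z - d%:Z + 1 /\
  2 * tau%:Z = d%:Z * (d%:Z - 1) + 2 * r%:Z * (d%:Z - r%:Z - 2) 
     - (\sum_i eps i ^ 2)%:Z + (\sum_i eps i)%:Z.
Proof.
move=> -> d_gt0 H len0.
set E := (\sum_i eps i)%N; set Q := (\sum_i eps i ^ 2)%N.
(* Termwise, for [e <= n], this is [(n-e+1)(n-e+2) = (n+1)(n+2) - (2n+3)e + e^2]. *)
have S n : (n0 <= n)%N -> (\sum_i 'C(n - eps i + 2, 2))%:Z * 2 =
    p%:Z * (n%:Z + 1) * (n%:Z + 2) - (2 * n%:Z + 3) * E%:Z + Q%:Z.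
  move=> len; rewrite /E /Q; elim: p eps len0 {H E Q} => [|p IH] eps len0.
    by rewrite !big_ord0; lia.
  rewrite !big_ord_recr /= !PoszD mulrDl bin2_int IH => [|i]; last exact: len0.
  have := len0 ord_max; have := bin2_int (n - eps ord_max).
  by move=> _ le0; rewrite -subzn ?(leq_trans le0) // -mulnn PoszM; ring.
have P n : (n0 <= n)%N ->
   (p%:Z + 2) * (n%:Z + 1) * (n%:Z + 2)
     + (n%:Z + r%:Z + d%:Z) * (n%:Z + r%:Z + d%:Z + 1) =
   3 * (n%:Z + r%:Z + 1) * (n%:Z + r%:Z + 2) + 2 * tau%:Z
     + (p%:Z * (n%:Z + 1) * (n%:Z + 2) - (2 * n%:Z + 3) * E%:Z + Q%:Z).
  move=> len; have := S n len; have := H n len.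
  have := bin2_int n; have := bin2_int (n + r); have := bin2_int (n + r + d.-1).
  have -> : (n + r + d.-1)%:Z = n%:Z + r%:Z + d%:Z - 1 by lia.
  rewrite !PoszD => h1 h2 h3 h4 h5; have := congr1 Posz h4; rewrite !PoszD !PoszM.
  nia.
(* Two consecutive values determine an affine function: their difference isolates the linear
   coefficient. *)
have P0 := P n0 (leqnn _); have P1 := P n0.+1 (leqnSn _).
have EE : E%:Z = 2 * r%:Z - d%:Z + 1 by nia.
split=> //.
nia.
Qed.

(** * Positivity of the syzygy degrees *)

Lemma dhomog0_mpolyC {n : nat} {R : nzRingType} (p : {mpoly R[n]}) :
  p \is 0.-homog -> p = (p@_0%MM)%:MP.
Proof.
move=> hp; apply/mpolyP => m; rewrite mcoeffC.
have [->|nz] := eqVneq m 0%MM; first by rewrite mulr1.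
by rewrite mulr0 (dhomog_nemf_coeff hp) //= mdeg_eq0.
Qed.

(** A syzygy of degree 0 has constant entries, and a nonzero constant entry would express one
    generator through the others, against the minimality of [g]. *)
Lemma min_syz_deg_gt0 {K : numClosedFieldType} {m n p : nat} {M}
    (g : 'I_m -> 'I_n -> {mpoly K[3]}) (deg : 'I_m -> nat)
    (s : 'I_p -> 'I_m -> {mpoly K[3]}) (eps : 'I_p -> nat) :
  min_homog_gens M g deg -> min_homog_gens (@syz K m n g) s eps ->
  forall i, (0 < eps i)%N.
Proof.
move=> [_ _ _ gmin] [ssyz hs _ smin] i; rewrite lt0n; apply/eqP => e0.
(* A zero row would be redundant, against the minimality of [s]. *)
have [j nzj] : exists j, s i j != 0.
  apply/existsP; rewrite -negb_forall; apply/negP => /forallP s0.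
  apply: (smin i); exists (fun _ => 0) => k.
  by rewrite big1 => [|j _]; [apply/eqP | rewrite mul0r].
have sC l : s i l = ((s i l)@_0%MM)%:MP by apply: dhomog0_mpolyC; have := hs i l; rewrite e0.
set c := fun l => (s i l)@_0%MM in sC.
have nzc : c j != 0 by apply: contraNneq nzj => cj0; rewrite sC -/(c j) cj0 mpolyC0.
(* The syzygy is solved for [g j]. The coefficient at [l = j] is harmless, since that generator has
   been replaced by 0. *)
apply: (gmin j); exists (fun l => (- (c l / c j))%:MP) => k.
rewrite (bigD1 j) //= eqxx mulr0 add0r.
have := ssyz i k; rewrite (bigD1 j) //= => /eqP; rewrite addr_eq0 => /eqP E.
have -> : g j k = (c j)^-1 *: (s i j * g j k).
  by rewrite sC mul_mpolyC scalerA mulVf ?scale1r.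
rewrite E scalerN scaler_sumr -sumrN; apply: eq_bigr => l /negbTE ->.
by rewrite sC !mul_mpolyC scalerA mulrC scaleNr.
Qed.

(** * Monotone positive sequences with total excess two *)

(** The excesses [eps i - 1] form a monotone sequence of naturals with sum 2, so the nonzero ones
    are either a final 2 or two final 1s. *)
Lemma monotone_excess2 (q : nat) (eps : 'I_q.+2 -> nat) :
  (forall i, (0 < eps i)%N) ->
  (forall i j : 'I_q.+2, (i <= j)%N -> (eps i <= eps j)%N) ->
  (\sum_i eps i = q.+4)%N ->
  ((forall j, eps j = if val j == q.+1 then 3%N else 1%N) /\
    (\sum_i eps i ^ 2 = q + 10)%N) \/
  ((forall j, eps j = if (q <= val j)%N then 2%N else 1%N) /\
    (\sum_i eps i ^ 2 = q + 8)%N).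
Proof.
move=> eps_gt0 mono; rewrite !big_ord_recr /=.
set w := fun i : 'I_q => widen_ord (leqnSn q.+1) (widen_ord (leqnSn q) i).
set a := widen_ord _ ord_max; set b := ord_max.
have caseI (i : 'I_q.+2) : [\/ exists l, i = w l, i = a | i = b].
  have [lti|gei] := ltnP i q; first by apply: Or31; exists (Ordinal lti); apply: val_inj.
  have [lti|gtq] := ltnP i q.+1; [apply: Or32 | apply: Or33]; apply: val_inj => /=;
    have := ltn_ord i; lia.
have leab : (eps a <= eps b)%N by apply: mono => /=.
have lewa i : (eps (w i) <= eps a)%N by apply: mono => /=; apply: ltnW.
have sumE : (\sum_(i < q) eps (w i) = \sum_(i < q) (eps (w i) - 1) + q)%N.
  have q1 : (\sum_(i < q) 1 = q)%N by rewrite sum1_card card_ord.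
  by rewrite -[X in _ = (_ + X)%N]q1 -big_split; apply: eq_bigr => i _; rewrite /= subnK.
rewrite -/(w _) sumE => sumT.
(* If [eps a] exceeds 1, so does [eps b], and the two exhaust the excess; otherwise monotonicity
   forces every earlier term to be 1. *)
have rest0 : (\sum_(i < q) (eps (w i) - 1) = 0)%N.
  have [gta|lea] := ltnP 1 (eps a); first by lia.
  by apply: big1 => i _; have := lewa i; lia.
have w1 i : eps (w i) = 1%N.
  move/eqP: rest0; rewrite sum_nat_eq0 => /forallP/(_ i)/=.
  by have := eps_gt0 (w i); lia.
have sq : (\sum_(i < q) eps (w i) ^ 2 = q)%N.
  by under eq_bigr => i _ do rewrite w1; rewrite sum1_card card_ord.
have a_gt0 := eps_gt0 a; rewrite sq.
have [[ea eb]|[ea eb]] : (eps a = 1 /\ eps b = 3 \/ eps a = 2 /\ eps b = 2)%N by lia.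
  left; split; last by rewrite ea eb; lia.
  move=> j; case: (caseI j) => [[l ->]|->|->] /=; rewrite ?w1 ?ea ?eb ?eqxx //; last first.
    by rewrite ltn_eqF.
  by have := ltn_ord l; case: eqP => //; lia.
right; split; last by rewrite ea eb; lia.
move=> j; case: (caseI j) => [[l ->]|->|->] /=; rewrite ?w1 ?ea ?eb ?leqnn ?leqnSn //.
by rewrite leqNgt ltn_ord.
Qed.

(** * The two possible resolutions and their Tjurina numbers *)

Theorem theorem3p3 (K : numClosedFieldType) (d r m : nat) (f : {mpoly K[3]})
  (g : 'I_m -> 'I_3 -> {mpoly K[3]})
  (s : 'I_(m - 2) -> 'I_m -> {mpoly K[3]}) (eps : 'I_(m - 2) -> nat) (tau : nat) :
  (3 <= d)%N -> f \is d.-homog -> reduced f -> ~ lines_through_point d f ->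
  min_homog_gens (@D0 K f) g (fun _ => r) ->
  (3 < m)%N ->
  ((2 * r)%:Z - d%:Z + 3) - m%:Z = 2 ->
  min_homog_gens (@syz K m 3 g) s eps ->
  (forall i j : 'I_(m - 2), (i <= j)%N -> (eps i <= eps j)%N) ->
  tjurina f tau ->
  ((forall j : 'I_(m - 2), eps j = if val j == (m - 3)%N then 3%N else 1%N) /\
    tau%:Z = ((d * (d - 1)) %/ 2)%N%:Z - 3 + r%:Z * (d%:Z - r%:Z - 2))
  \/
  ((forall j : 'I_(m - 2), eps j = if (m - 4 <= val j)%N then 2%N else 1%N) /\
    tau%:Z = ((d * (d - 1)) %/ 2)%N%:Z - 2 + r%:Z * (d%:Z - r%:Z - 2)).
Proof.
move=> le3d hf [nzf _] _ gD0 lt3m excess ssyz mono [N tauN].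
have d_gt0 : (0 < d)%N by apply: leq_trans le3d.
have eps_gt0 := min_syz_deg_gt0 _ _ _ _ gD0 ssyz.
(* This bound passes the stabilization threshold [N] and dominates every [eps i], so that no
   [n - eps i] is truncated. *)
pose n0 := (N + \sum_i eps i)%N.
have le_n0 i : (eps i <= n0)%N.
  by rewrite /n0 (bigD1 i) //= addnCA leq_addr.
have le2m : (m - 2 + 2 <= m)%N by lia.
have [|n len|] := hilbert_count_coefs (m - 2) m r d tau eps n0 _ d_gt0 _ le_n0; first by lia.
  apply: (hilbert_count f g s) => // [i|]; first exact: leq_trans len.
  by apply: tauN; rewrite /n0 in len; lia.
(* As [d * (d - 1)] is even, the division by 2 in the statement is exact. *)
have dd : (d%:Z * (d%:Z - 1) = 2 * ((d * (d - 1)) %/ 2)%N%:Z)%R.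
  have : (2 %| d * (d - 1))%N.
    by rewrite dvdn2 oddM oddB // addbT andbN.
  by move=> /divnK; nia.
(* Everything is expressed through [m - 2], which can then be generalized to [q.+2]. *)
have -> : (m - 4 = m - 2 - 2)%N by lia.
have -> : (m - 3 = m - 2 - 1)%N by lia.
have hm : m = (m - 2 + 2)%N by lia.
have lt1 : (1 < m - 2)%N by lia.
move: excess; rewrite {1}hm.
clear - mono eps_gt0 lt1 dd.
move: (m - 2)%N lt1 eps mono eps_gt0 => [|[|q]] // _ eps mono eps_gt0 excess sumE tauE.
(* The sum of the [eps i] is [m = q + 4]. Subtracting it from the sum of squares, [q + 10] or
   [q + 8], leaves 6 or 4, and halving gives the corrections 3 and 2 to [tau]. *)
have [||] := monotone_excess2 q eps eps_gt0 mono; first by lia.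
  move=> [epsE Q]; left; split; last by lia.
  by move=> j; rewrite epsE subn1.
move=> [epsE Q]; right; split; last by lia.
by move=> j; rewrite epsE subn2.
Qed.
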